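(* Let $L=[h_1,\dots,h_6]$ be a 6R linkage with $\dim_{\mathbb{C}}K_{sym}<2$ such that $K_{sym}$ has a non-degenerate component $K_0\subset K_{sym}^+$. Let $r=\operatorname{rank}(\mathbf{M}^{\dagger})$. If $r=2$ or $r=3$, then $L$ is line symmetric or $L$ has the parallel property.
   Context: Let $\mathbb{DH}$ be the algebra of dual quaternions, the 8-dimensional real algebra with basis $1,\mathbf i,\mathbf j,\mathbf k,\epsilon,\epsilon\mathbf i,\epsilon\mathbf j,\epsilon\mathbf k$, where $\mathbf i,\mathbf j,\mathbf k$ multiply as quaternions, $\epsilon$ is central and $\epsilon^2=0$. Every $h\in\mathbb{DH}$ is uniquely $h=p+\epsilon q$ with quaternions $p,q$; $p=\mathrm{primal}(h)$ is the primal part. A (rotation) line is represented by $h\in\mathbb{DH}$ with $h^2=-1$; the rotation about it by angle $\phi$ is represented, up to nonzero real scalars, by $t-h$ with $t=\cot(\phi/2)\in\mathbb{R}\cup\{\infty\}$, where for $t=\infty$ the factor $t-h$ (and likewise $t+h$) is read as $1$. Lines $h,h'$ are parallel, $h\parallel h'$, if $\mathrm{primal}(h)=\pm\mathrm{primal}(h')$. A 6R linkage is a tuple $L=[h_1,\dots,h_6]$ of dual quaternions with $h_i^2=-1$ for all $i$. Its configuration set $K_L$ is the set of $(t_1,\dots,t_6)\in(\mathbb{R}\cup\{\infty\})^6$ with $(t_1-h_1)(t_2-h_2)\cdots(t_6-h_6)\in\mathbb{R}\setminus\{0\}$. $K_{sym}$ is the subset of $K_L$ with $t_1=t_4$, $t_2=t_5$,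 $t_3=t_6$; its points are written $(t_1,t_2,t_3)$. $\dim_{\mathbb{C}}K_{sym}$ is the dimension of the set of complex solutions of the same conditions ($t_i\in\mathbb{C}\cup\{\infty\}$, product in $\mathbb{C}\setminus\{0\}$). A non-degenerate component of $K_{sym}$ is an irreducible one-dimensional component on which none of the coordinates $t_1,t_2,t_3$ is constant. For $(t_1,t_2,t_3)\in K_{sym}$ one has $(t_1-h_1)(t_2-h_2)(t_3-h_3)=\lambda(t_3+h_6)(t_2+h_5)(t_1+h_4)$ with $\lambda\in\{1,-1\}$; $K_{sym}^+$ is the subset of $K_{sym}$ where $\lambda=1$. $L$ is line symmetric if there is $l\in\mathbb{DH}$ with $l^2=-1$ and $h_1=lh_4l^{-1}$, $h_2=lh_5l^{-1}$, $h_3=lh_6l^{-1}$. $L$ has the parallel property if, possibly after a cyclic permutation of the indices $1,\dots,6$, $h_1\parallel h_4$, $h_2\parallel h_3$ and $h_5\parallel h_6$. Put $g_i=h_i+h_{i+3}$ for $i=1,2,3$. The matrix $\mathbf{M}^{\dagger}$ (the $\lambda$-matrix of $L$) is the $6\times 7$ matrix over $\mathbb{DH}$ $$\left[\begin{array}{ccccccc} g_3&g_2&g_1&h_5h_4-h_1h_2&h_6h_4-h_1h_3&h_6h_5-h_2h_3&h_6h_5h_4+h_1h_2h_3\\ g_3&g_2&g_1&h_1h_5-h_2h_4&h_1h_6-h_3h_4&h_6h_5-h_2h_3&h_1h_6h_5+h_2h_3h_4\\ g_3&g_2&g_1&h_2h_1-h_4h_5&h_1h_6-h_3h_4&h_2h_6-h_3h_5&h_2h_1h_6+h_3h_4h_5\\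 g_3&g_2&g_1&h_2h_1-h_4h_5&h_3h_1-h_4h_6&h_3h_2-h_5h_6&h_3h_2h_1+h_4h_5h_6\\ g_3&g_2&g_1&h_4h_2-h_5h_1&h_4h_3-h_6h_1&h_3h_2-h_5h_6&h_4h_3h_2+h_5h_6h_1\\ g_3&g_2&g_1&h_5h_4-h_1h_2&h_4h_3-h_6h_1&h_5h_3-h_6h_2&h_5h_4h_3+h_6h_1h_2 \end{array}\right].$$ It is regarded as a real $48\times 7$ matrix by replacing each entry by the column of its 8 real coordinates, and $\operatorname{rank}(\mathbf{M}^{\dagger})$ is its real rank. *)

(* Defs.v *)
From HB Require Import structures.
From mathcomp Require Import all_boot all_order all_algebra.
From mathcomp Require Import boolp classical_sets reals complex.
From mathcomp Require Import ring.

Set Implicit Arguments.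
Unset Strict Implicit.
Unset Printing Implicit Defensive.

Import GRing.Theory.
Local Open Scope classical_set_scope.
Local Open Scope ring_scope.

(** The coefficient field [F] is a parameter because both the real algebra and
    its complexification are needed.  Over [F = R[i]] there are zero divisors,
    so invertibility is tested with the norm form [qnorm]. *)

Record quat (F : Type) := Quat { q1 : F; qi : F; qj : F; qk : F }.

Section QuatEncoding.
Variable F : Type.
Definition tuple_of_quat (a : quat F) := (q1 a, qi a, qj a, qk a).
Definition quat_of_tuple (t : F * F * F * F) :=
  Quat t.1.1.1 t.1.1.2 t.1.2 t.2.
Lemma tuple_of_quatK : cancel tuple_of_quat quat_of_tuple.
Proof. by case. Qed.
End QuatEncoding.

HB.instance Definition _ (F : choiceType) :=
  Choice.copy (quat F) (can_type (@tuple_of_quatK F)).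

Section QuatAlgebra.
Variable F : fieldType.
Implicit Types a b c : quat F.

Definition qadd a b :=
  Quat (q1 a + q1 b) (qi a + qi b) (qj a + qj b) (qk a + qk b).
Definition qopp a := Quat (- q1 a) (- qi a) (- qj a) (- qk a).
Definition qscale (x : F) a := Quat (x * q1 a) (x * qi a) (x * qj a) (x * qk a).
Definition qmul a b := Quat
  (q1 a * q1 b - qi a * qi b - qj a * qj b - qk a * qk b)
  (q1 a * qi b + qi a * q1 b + qj a * qk b - qk a * qj b)
  (q1 a * qj b - qi a * qk b + qj a * q1 b + qk a * qi b)
  (q1 a * qk b + qi a * qj b - qj a * qi b + qk a * q1 b).
Definition qconj a := Quat (q1 a) (- qi a) (- qj a) (- qk a).
Definition qnorm a := q1 a ^+ 2 + qi a ^+ 2 + qj a ^+ 2 + qk a ^+ 2.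

Fact qaddA : associative qadd.
Proof. by move=> [????] [????] [????]; congr Quat => /=; ring. Qed.
Fact qaddC : commutative qadd.
Proof. by move=> [????] [????]; congr Quat => /=; ring. Qed.
Fact qadd0 : left_id (Quat 0 0 0 0) qadd.
Proof. by move=> [????]; congr Quat => /=; ring. Qed.
Fact qaddN : left_inverse (Quat 0 0 0 0) qopp qadd.
Proof. by move=> [????]; congr Quat => /=; ring. Qed.
HB.instance Definition _ :=
  GRing.isZmodule.Build (quat F) qaddA qaddC qadd0 qaddN.

Fact qmulA : associative qmul.
Proof. by move=> [????] [????] [????]; congr Quat => /=; ring. Qed.
Fact qmul1l : left_id (Quat 1 0 0 0) qmul.
Proof. by move=> [????]; congr Quat => /=; ring. Qed.
Fact qmul1r : right_id (Quat 1 0 0 0) qmul.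
Proof. by move=> [????]; congr Quat => /=; ring. Qed.
Fact qmulDl : left_distributive qmul +%R.
Proof. by move=> [????] [????] [????]; congr Quat => /=; ring. Qed.
Fact qmulDr : right_distributive qmul +%R.
Proof. by move=> [????] [????] [????]; congr Quat => /=; ring. Qed.
Fact q1_neq0 : Quat 1 0 0 0 != 0 :> quat F.
Proof. by apply/eqP => -[] /eqP; rewrite oner_eq0. Qed.
HB.instance Definition _ := GRing.Zmodule_isNzRing.Build (quat F)
  qmulA qmul1l qmul1r qmulDl qmulDr q1_neq0.

Fact qscaleA x y a : qscale x (qscale y a) = qscale (x * y) a.
Proof. by case: a => *; congr Quat => /=; ring. Qed.
Fact qscale1 : left_id 1 qscale.
Proof. by move=> [????]; congr Quat => /=; ring. Qed.
Fact qscaleDr : right_distributive qscale +%R.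
Proof. by move=> ? [????] [????]; congr Quat => /=; ring. Qed.
Fact qscaleDl a : {morph qscale^~ a : x y / x + y}.
Proof. by case: a => * ??; congr Quat => /=; ring. Qed.
HB.instance Definition _ := GRing.Zmodule_isLmodule.Build F (quat F)
  qscaleA qscale1 qscaleDr qscaleDl.

Fact qscaleAl (x : F) a b : x *: (a * b) = (x *: a) * b.
Proof. by case: a b => [????] [????]; congr Quat => /=; ring. Qed.
HB.instance Definition _ := GRing.Lmodule_isLalgebra.Build F (quat F) qscaleAl.
Fact qscaleAr (x : F) a b : x *: (a * b) = a * (x *: b).
Proof. by case: a b => [????] [????]; congr Quat => /=; ring. Qed.
HB.instance Definition _ := GRing.Lalgebra_isAlgebra.Build F (quat F) qscaleAr.

Definition qunit : pred (quat F) := fun a => qnorm a != 0.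
Definition qinv a := if qunit a then (qnorm a)^-1 *: qconj a else a.

Lemma qnormM a b : qnorm (a * b) = qnorm a * qnorm b.
Proof. by case: a b => [????] [????]; rewrite /qnorm /=; ring. Qed.
Lemma qnorm1 : qnorm (1 : quat F) = 1.
Proof. by rewrite /qnorm /=; ring. Qed.
Lemma qconjl a : qconj a * a = qnorm a *: 1.
Proof. by case: a => ????; congr Quat; rewrite /qnorm /=; ring. Qed.
Lemma qconjr a : a * qconj a = qnorm a *: 1.
Proof. by case: a => ????; congr Quat; rewrite /qnorm /=; ring. Qed.

Fact qmulV : {in qunit, left_inverse 1 qinv *%R}.
Proof.
move=> a ua; have ua' : qunit a by [].
by rewrite /qinv ua' -scalerAl qconjl scalerA mulVf ?scale1r.
Qed.
Fact qmulrV : {in qunit, right_inverse 1 qinv *%R}.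
Proof.
move=> a ua; have ua' : qunit a by [].
by rewrite /qinv ua' -scalerAr qconjr scalerA mulVf ?scale1r.
Qed.
Fact qunitP a b : b * a = 1 /\ a * b = 1 -> qunit a.
Proof.
move=> [] /(congr1 qnorm); rewrite qnormM qnorm1 => /eqP ba _.
by apply: contraTneq ba => ->; rewrite mulr0 eq_sym oner_eq0.
Qed.
Fact qinv_out : {in [predC qunit], qinv =1 id}.
Proof. by move=> a; rewrite inE /qinv => /negPf; rewrite /in_mem /= => ->. Qed.
HB.instance Definition _ := GRing.NzRing_hasMulInverse.Build (quat F)
  qmulV qmulrV qunitP qinv_out.

End QuatAlgebra.

(** [DQuat p q] is [p + eps q]. *)

Record dquat (F : Type) := DQuat { primal : quat F; dualpart : quat F }.

Section DQuatEncoding.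
Variable F : Type.
Definition pair_of_dquat (h : dquat F) := (primal h, dualpart h).
Definition dquat_of_pair (t : quat F * quat F) := DQuat t.1 t.2.
Lemma pair_of_dquatK : cancel pair_of_dquat dquat_of_pair.
Proof. by case. Qed.
End DQuatEncoding.

HB.instance Definition _ (F : choiceType) :=
  Choice.copy (dquat F) (can_type (@pair_of_dquatK F)).

Section DQuatAlgebra.
Variable F : fieldType.
Implicit Types h g : dquat F.

Definition dadd h g := DQuat (primal h + primal g) (dualpart h + dualpart g).
Definition dopp h := DQuat (- primal h) (- dualpart h).
Definition dscale (x : F) h := DQuat (x *: primal h) (x *: dualpart h).
Definition dmul h g := DQuat (primal h * primal g)
  (primal h * dualpart g + dualpart h * primal g).

Fact daddA : associative dadd.
Proof. by move=> [??] [??] [??]; congr DQuat; rewrite /= addrA. Qed.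
Fact daddC : commutative dadd.
Proof. by move=> [??] [??]; congr DQuat; rewrite /= addrC. Qed.
Fact dadd0 : left_id (DQuat 0 0) dadd.
Proof. by move=> [??]; congr DQuat; rewrite /= add0r. Qed.
Fact daddN : left_inverse (DQuat 0 0) dopp dadd.
Proof. by move=> [??]; congr DQuat; rewrite /= addNr. Qed.
HB.instance Definition _ :=
  GRing.isZmodule.Build (dquat F) daddA daddC dadd0 daddN.

Fact dmulA : associative dmul.
Proof.
move=> [??] [??] [??]; congr DQuat; rewrite /= ?mulrA //.
by rewrite mulrDr mulrDl !mulrA addrA.
Qed.
Fact dmul1l : left_id (DQuat 1 0) dmul.
Proof. by move=> [??]; congr DQuat; rewrite /= !mul1r ?mul0r ?addr0. Qed.
Fact dmul1r : right_id (DQuat 1 0) dmul.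
Proof. by move=> [??]; congr DQuat; rewrite /= !mulr1 ?mulr0 ?add0r. Qed.
Fact dmulDl : left_distributive dmul +%R.
Proof. by move=> [??] [??] [??]; congr DQuat; rewrite /= !mulrDl // addrACA. Qed.
Fact dmulDr : right_distributive dmul +%R.
Proof. by move=> [??] [??] [??]; congr DQuat; rewrite /= !mulrDr // addrACA. Qed.
Fact d1_neq0 : DQuat 1 0 != 0 :> dquat F.
Proof. by apply/eqP => -[] /eqP; rewrite oner_eq0. Qed.
HB.instance Definition _ := GRing.Zmodule_isNzRing.Build (dquat F)
  dmulA dmul1l dmul1r dmulDl dmulDr d1_neq0.

Fact dscaleA x y h : dscale x (dscale y h) = dscale (x * y) h.
Proof. by case: h => *; congr DQuat; rewrite /= scalerA. Qed.
Fact dscale1 : left_id 1 dscale.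
Proof. by move=> [??]; congr DQuat; rewrite /= scale1r. Qed.
Fact dscaleDr : right_distributive dscale +%R.
Proof. by move=> ? [??] [??]; congr DQuat; rewrite /= scalerDr. Qed.
Fact dscaleDl h : {morph dscale^~ h : x y / x + y}.
Proof. by case: h => * ??; congr DQuat; rewrite /= scalerDl. Qed.
HB.instance Definition _ := GRing.Zmodule_isLmodule.Build F (dquat F)
  dscaleA dscale1 dscaleDr dscaleDl.

Fact dscaleAl (x : F) h g : x *: (h * g) = (x *: h) * g.
Proof.
by case: h g => [??] [??]; congr DQuat; rewrite /= ?scalerDr ?scalerAl ?scalerAr.
Qed.
HB.instance Definition _ := GRing.Lmodule_isLalgebra.Build F (dquat F) dscaleAl.
Fact dscaleAr (x : F) h g : x *: (h * g) = h * (x *: g).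
Proof.
by case: h g => [??] [??]; congr DQuat; rewrite /= ?scalerDr -?scalerAl -?scalerAr.
Qed.
HB.instance Definition _ := GRing.Lalgebra_isAlgebra.Build F (dquat F) dscaleAr.

Definition dunit : pred (dquat F) := fun h => primal h \is a GRing.unit.
Definition dinv h := if dunit h
  then DQuat (primal h)^-1 (- ((primal h)^-1 * dualpart h * (primal h)^-1))
  else h.

Fact dmulV : {in dunit, left_inverse 1 dinv *%R}.
Proof.
move=> h uh; have uh' : dunit h by []; rewrite /dinv uh'.
by congr DQuat; rewrite /= ?mulVr // mulNr divrK // addrN.
Qed.
Fact dmulrV : {in dunit, right_inverse 1 dinv *%R}.
Proof.
move=> h uh; have uh' : dunit h by []; rewrite /dinv uh'.
by congr DQuat; rewrite /= ?divrr // mulrN -!mulrA mulVKr // addNr.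
Qed.
Fact dunitP h g : g * h = 1 /\ h * g = 1 -> dunit h.
Proof.
move=> [/(congr1 (@primal F)) gh /(congr1 (@primal F)) hg].
by apply/unitrP; exists (primal g).
Qed.
Fact dinv_out : {in [predC dunit], dinv =1 id}.
Proof. by move=> h; rewrite inE /dinv => /negPf; rewrite /in_mem /= => ->. Qed.
HB.instance Definition _ := GRing.NzRing_hasMulInverse.Build (dquat F)
  dmulV dmulrV dunitP dinv_out.

(** Coordinates with respect to [1, i, j, k, eps, eps i, eps j, eps k]. *)
Definition dcoord h : 'rV[F]_8 :=
  let p := primal h in let q := dualpart h in
  \row_k [:: q1 p; qi p; qj p; qk p; q1 q; qi q; qj q; qk q]`_k.

End DQuatAlgebra.

Definition map_quat (F K : Type) (f : F -> K) (a : quat F) :=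
  Quat (f (q1 a)) (f (qi a)) (f (qj a)) (f (qk a)).
Definition map_dquat (F K : Type) (f : F -> K) (h : dquat F) :=
  DQuat (map_quat f (primal h)) (map_quat f (dualpart h)).

(** [None] is the point at infinity of [F u {oo}]. *)
Definition P1 (F : Type) := option F.
Definition P1_3 (F : Type) := (P1 F * P1 F * P1 F)%type.

Section Zariski.
Variable F : fieldType.
Implicit Types (t : P1_3 F) (X Y Z A B : set (P1_3 F)).

(** Homogeneous coordinates: [Some a = (a : 1)] and [None = (1 : 0)]. *)
Definition hx (a : P1 F) : F := if a is Some x then x else 1.
Definition hy (a : P1 F) : F := if a is Some _ then 1 else 0.

(** A form of tridegree [(tdeg1, tdeg2, tdeg3)] in the three pairs of variables
    [(x1, y1), (x2, y2), (x3, y3)]; [tcoef i j k] is the coefficient of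
    [x1^i y1^(tdeg1-i) x2^j y2^(tdeg2-j) x3^k y3^(tdeg3-k)].  Coefficients whose
    indices exceed the tridegree are not used. *)
Record triform := Triform {
  tdeg1 : nat; tdeg2 : nat; tdeg3 : nat;
  tcoef : nat -> nat -> nat -> F }.

Definition hmon (d i : nat) (a : P1 F) : F := hx a ^+ i * hy a ^+ (d - i).

Definition triform_eval (f : triform) t : F :=
  \sum_(i < (tdeg1 f).+1) \sum_(j < (tdeg2 f).+1) \sum_(k < (tdeg3 f).+1)
    tcoef f i j k *
    (hmon (tdeg1 f) i t.1.1 * hmon (tdeg2 f) j t.1.2 * hmon (tdeg3 f) k t.2).

(** Zariski closed subsets of [(P^1)^3]: common zero loci of trihomogeneous
    polynomials. *)
Definition zclosed A :=
  exists S : set triform,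
    A = [set t | forall f, S f -> triform_eval f t = 0].

Definition zclosed_in X Z := exists2 A, zclosed A & Z = X `&` A.

Definition zirreducible Z :=
  Z !=set0 /\
  forall A B, zclosed A -> zclosed B -> Z `<=` A `|` B -> Z `<=` A \/ Z `<=` B.

Definition zcomponent X Z :=
  [/\ Z `<=` X, zirreducible Z &
    forall Y, Y `<=` X -> zirreducible Y -> Z `<=` Y -> Y = Z].

(** Krull dimension: [zdim_ge X n] holds when there is a chain
    [Z 0 < Z 1 < ... < Z n] of irreducible closed subsets of [X].  In particular
    the empty set has dimension less than every natural number. *)
Definition zdim_ge X (n : nat) :=
  exists Z : nat -> set (P1_3 F),
    (forall i, (i <= n)%N -> zclosed_in X (Z i) /\ zirreducible (Z i)) /\
    (forall i, (i < n)%N -> Z i `<` Z i.+1).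
Definition zdim_lt X (n : nat) := ~ zdim_ge X n.
Definition zdim_eq X (n : nat) := zdim_ge X n /\ zdim_lt X n.+1.

End Zariski.

(** A 6-tuple [L] stands for [h_1, ..., h_6] with [h_i = L`_(i-1)]. *)

Section Linkage.
Variable F : fieldType.
Implicit Types (L : 6.-tuple (dquat F)) (t : P1_3 F).

Definition is_linkage L := forall i : 'I_6, tnth L i ^+ 2 = -1.

Definition rot_minus (a : P1 F) (h : dquat F) : dquat F :=
  if a is Some x then x%:A - h else 1.
Definition rot_plus (a : P1 F) (h : dquat F) : dquat F :=
  if a is Some x then x%:A + h else 1.

Definition K_conf L : set (6.-tuple (P1 F)) :=
  [set u | exists2 c : F, c != 0 &
    \prod_(i < 6) rot_minus (tnth u i) (tnth L i) = c%:A].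

Definition sym_point t : 6.-tuple (P1 F) :=
  [tuple t.1.1; t.1.2; t.2; t.1.1; t.1.2; t.2].

(** The closed condition [t_1 = t_4, t_2 = t_5, t_3 = t_6] identifies [K_sym]
    with a subset of [(P^1)^3]. *)
Definition K_sym L : set (P1_3 F) := [set t | K_conf L (sym_point t)].

Definition K_sym_plus L : set (P1_3 F) :=
  [set t | K_sym L t /\
    rot_minus t.1.1 L`_0 * rot_minus t.1.2 L`_1 * rot_minus t.2 L`_2 =
    rot_plus t.2 L`_5 * rot_plus t.1.2 L`_4 * rot_plus t.1.1 L`_3].

Definition nondegenerate_component L (K0 : set (P1_3 F)) :=
  [/\ zcomponent (K_sym L) K0, zdim_eq K0 1,
    ~ (exists a, forall t, K0 t -> t.1.1 = a),
    ~ (exists a, forall t, K0 t -> t.1.2 = a) &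
    ~ (exists a, forall t, K0 t -> t.2 = a)].

Definition parallel (h g : dquat F) :=
  primal h = primal g \/ primal h = - primal g.

Definition line_symmetric L :=
  exists l : dquat F, [/\ l ^+ 2 = -1, L`_0 = l * L`_3 * l^-1,
    L`_1 = l * L`_4 * l^-1 & L`_2 = l * L`_5 * l^-1].

(** [rot n] ranges over the cyclic permutations of [h_1, ..., h_6]. *)
Definition parallel_property L :=
  exists n : nat, let L' := rot n L in
    [/\ parallel L'`_0 L'`_3, parallel L'`_1 L'`_2 & parallel L'`_4 L'`_5].

Definition lambda_matrix L : 'M[dquat F]_(6, 7) :=
  let h1 := L`_0 in let h2 := L`_1 in let h3 := L`_2 in
  let h4 := L`_3 in let h5 := L`_4 in let h6 := L`_5 in
  let g1 := h1 + h4 in let g2 := h2 + h5 in let g3 := h3 + h6 in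
  \matrix_(i < 6, j < 7) (nth [::] [::
    [:: g3; g2; g1; h5 * h4 - h1 * h2; h6 * h4 - h1 * h3; h6 * h5 - h2 * h3;
        h6 * h5 * h4 + h1 * h2 * h3];
    [:: g3; g2; g1; h1 * h5 - h2 * h4; h1 * h6 - h3 * h4; h6 * h5 - h2 * h3;
        h1 * h6 * h5 + h2 * h3 * h4];
    [:: g3; g2; g1; h2 * h1 - h4 * h5; h1 * h6 - h3 * h4; h2 * h6 - h3 * h5;
        h2 * h1 * h6 + h3 * h4 * h5];
    [:: g3; g2; g1; h2 * h1 - h4 * h5; h3 * h1 - h4 * h6; h3 * h2 - h5 * h6;
        h3 * h2 * h1 + h4 * h5 * h6];
    [:: g3; g2; g1; h4 * h2 - h5 * h1; h4 * h3 - h6 * h1; h3 * h2 - h5 * h6;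
        h4 * h3 * h2 + h5 * h6 * h1];
    [:: g3; g2; g1; h5 * h4 - h1 * h2; h4 * h3 - h6 * h1; h5 * h3 - h6 * h2;
        h5 * h4 * h3 + h6 * h1 * h2]] i)`_j.

(** The [48 x 7] matrix obtained by replacing each entry with the column of its
    eight coordinates. *)
Definition realify (M : 'M[dquat F]_(6, 7)) : 'M[F]_(6 * 8, 7) :=
  (\matrix_(j < 7) mxvec (\matrix_(i < 6, k < 8) dcoord (M i j) 0 k))^T.

End Linkage.

Definition complexify (R : realType) (L : 6.-tuple (dquat R)) :
    6.-tuple (dquat R[i]) :=
  map_tuple (map_dquat (real_complex R)) L.

(* Main.v *)
Require Import Defs.
From mathcomp Require Import all_boot all_order all_algebra.
From mathcomp Require Import boolp classical_sets reals complex.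
From mathcomp Require Import ring lra.
Set Implicit Arguments.
Unset Strict Implicit.
Unset Printing Implicit Defensive.
Import Order.TTheory GRing.Theory Num.Theory.
Local Open Scope classical_set_scope.
Local Open Scope ring_scope.

(** Write [g_i = h_i + h_(i+3)], and say that [g] swaps the pair [i] when
    [g h_(i+3) = h_i g] and [g h_i = h_(i+3) g].  A pure [g] with nonzero primal
    part that swaps all three pairs normalises to an axis of line symmetry, and
    [g_i] always swaps its own pair.

    Subtracting consecutive row blocks of the lambda-matrix gives equations of the
    curve that are affine and free of one variable; for [t_1] the coefficients of
    [t_3] and [t_2] are [g_2 h_4 - h_1 g_2] and [g_3 h_4 - h_1 g_3].  No
    coordinate is constant on the curve, so these vanish simultaneously.  If both
    pairs [i] and [j] fail to be swapped by some [g], this yields two independent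
    affine rows; as the rank is at most 3, the [g_i] are then real multiples of
    one another, which forces one of them to vanish, and with it one of the two
    affine rows.  Hence at least two of the three pairs, say 2 and 3, are swapped
    by every [g_i].

    Let [g] be pure with nonzero primal part, swap the pairs 2 and 3, and commute
    with [g_1].  Then [X = g h_4 - h_1 g] is a dual number, and conjugating the
    closure equation shows that [X] kills the vector part of
    [(t_3 + h_3)(t_2 + h_2)]; it also kills [g_1].  So either [X = 0] and [g]
    swaps the pair 1 too, or [h_1, h_4] and [h_2, h_3] and [h_5, h_6] are
    parallel.  One of the [g_i] serves as [g] unless all of them have zero primal
    part, and then [g] is the common perpendicular of [h_2] and [h_3] moved so as
    to swap the pairs 2 and 3. *)

(** * Conjugation, dual numbers and lines over a field *)

Section Algebra.
Variable F : fieldType.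
Implicit Types g h x y X : dquat F.

Definition dconj h := DQuat (qconj (primal h)) (qconj (dualpart h)).

Lemma dconjM x y : dconj (x * y) = dconj y * dconj x.
Proof.
case: x y => [[????] [????]] [[????] [????]].
by congr DQuat; congr Quat => /=; ring.
Qed.

Lemma dconjB x y : dconj (x - y) = dconj x - dconj y.
Proof.
case: x y => [[????] [????]] [[????] [????]].
by congr DQuat; congr Quat => /=; ring.
Qed.

Lemma dconjD x y : dconj (x + y) = dconj x + dconj y.
Proof.
case: x y => [[????] [????]] [[????] [????]].
by congr DQuat; congr Quat => /=; ring.
Qed.

Lemma dconj_alg (a : F) : dconj a%:A = a%:A.
Proof. by congr DQuat; congr Quat => /=; ring. Qed.

Lemma dconjK x : dconj (dconj x) = x.
Proof.
by case: x => [[????] [????]]; congr DQuat; congr Quat => /=; rewrite opprK.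
Qed.

Definition closes h1 h2 h3 h4 h5 h6 (t1 t2 t3 : F) :=
  (t1%:A - h1) * (t2%:A - h2) * (t3%:A - h3) =
  (t3%:A + h6) * (t2%:A + h5) * (t1%:A + h4).

Lemma dconj_fixed X : (2 : F) != 0 -> dconj X = X ->
  exists a b : F, X = DQuat a%:A b%:A.
Proof.
case: X => [[a x y z] [b u v w]] two0 [].
move=> /eqP Hx /eqP Hy /eqP Hz /eqP Hu /eqP Hv /eqP Hw.
have neg0 (c : F) : - c == c -> c = 0.
  rewrite -subr_eq0 -opprD oppr_eq0 -mulr2n -mulr_natl mulf_eq0 (negPf two0).
  by move=> /eqP.
rewrite (neg0 _ Hx) (neg0 _ Hy) (neg0 _ Hz) (neg0 _ Hu) (neg0 _ Hv) (neg0 _ Hw).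
by exists a, b; congr DQuat; congr Quat => /=; ring.
Qed.

Lemma dual_scalar_comm (a b : F) x : DQuat a%:A b%:A * x = x * DQuat a%:A b%:A.
Proof. by case: x => [[????] [????]]; congr DQuat; congr Quat => /=; ring. Qed.

(** If a is nonzero, the primal part of the product already forces [primal x] to vanish. Otherwise
    the dual number is eps b with b nonzero, and the dual part of the product is b times
    [primal x]. *)
Lemma dual_scalar_mul_eq0 (a b : F) x :
  DQuat a%:A b%:A != 0 -> DQuat a%:A b%:A * x = 0 -> primal x = 0.
Proof.
case: x => p q X0 e.
have /= Hp : a *: p = 0 by rewrite -mulr_algl; exact: (congr1 (@primal F) e).
have [a0|a0] := eqVneq a 0; last by move/eqP: Hp; rewrite scaler_eq0 (negPf a0) => /eqP.
have b0 : b != 0 by apply: contra_neq X0 => ->; rewrite a0 !scale0r.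
have : a%:A * q + b%:A * p = 0 by exact: (congr1 (@dualpart F) e).
rewrite a0 scale0r mul0r add0r mulr_algl => /eqP.
by rewrite scaler_eq0 (negPf b0) => /eqP.
Qed.

(** Over the reals the second condition follows from the first ([line_of_sqr]); it is what
    conjugation arguments use. *)
Definition line h := h * h = -1 /\ dconj h = - h.

Definition swaps g h h' := g * h' = h * g /\ g * h = h' * g.

(** Both squares are -1, so the two sides of each equation expand to the same product minus 1. *)
Lemma swaps_sum h h' : line h -> line h' -> swaps (h + h') h h'.
Proof.
move=> [hh _] [hh' _].
by split; rewrite mulrDl mulrDr hh hh' // addrC.
Qed.

Lemma swapsC g h h' : swaps g h h' -> swaps g h' h.
Proof. by case. Qed.

End Algebra.

(** * Lines, axes and the closure equation over a real closed field *)

Section RealAlgebra.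
Variable R : rcfType.
Implicit Types g h x y X : dquat R.

(** A nonzero scalar part, primal or dual, would force the primal vector part to vanish, and then
    the square could not be -1 in an ordered field. *)
Lemma line_of_sqr h : h ^+ 2 = -1 -> line h.
Proof.
rewrite expr2 => hh; split=> //.
case: h hh => [[a x y z] [b u v w]] [] /= e1 e2 e3 e4 e5 e6 e7 e8.
have a0 : a = 0.
  have [//|a0] := eqVneq a 0.
  have x0 : x = 0 by apply: (mulfI a0); lra.
  have y0 : y = 0 by apply: (mulfI a0); lra.
  have z0 : z = 0 by apply: (mulfI a0); lra.
  exfalso; rewrite x0 y0 z0 in e1; nra.
have b0 : b = 0.
  have [//|b0] := eqVneq b 0.
  rewrite a0 in e1 e2 e3 e4 e5 e6 e7 e8.
  have x0 : x = 0 by apply: (mulfI b0); lra.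
  have y0 : y = 0 by apply: (mulfI b0); lra.
  have z0 : z = 0 by apply: (mulfI b0); lra.
  exfalso; rewrite x0 y0 z0 in e1; nra.
by rewrite a0 b0; congr DQuat; congr Quat => /=; ring.
Qed.

Lemma primal_unit x : primal x != 0 -> x \is a GRing.unit.
Proof.
case: x => [[a b c d] q] /= p0; rewrite qualifE /= /dunit /= qualifE /= /qunit /qnorm /=.
apply: contra_neq p0 => e.
have a0 : a = 0 by nra.
have b0 : b = 0 by nra.
have c0 : c = 0 by nra.
have d0 : d = 0 by nra.
by rewrite a0 b0 c0 d0.
Qed.

Lemma two_neq0 : (2 : R) != 0. Proof. by rewrite pnatr_eq0. Qed.

Lemma sqr_add1_neq0 (t : R) : t ^+ 2 + 1 != 0.
Proof. by apply: lt0r_neq0; rewrite ltr_wpDl ?sqr_ge0. Qed.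

Lemma line_rot_mul h (t : R) : line h ->
  (t%:A + h) * (t%:A - h) = (t ^+ 2 + 1)%:A.
Proof.
move=> [hh _]; rewrite mulrBr !mulrDl hh !mulr_algl mulr_algr addrKA opprK.
by rewrite scalerA -expr2 scalerDl scale1r.
Qed.

Lemma line_rot_mulC h (t : R) : line h ->
  (t%:A - h) * (t%:A + h) = (t ^+ 2 + 1)%:A.
Proof.
move=> [hh _]; rewrite mulrDr !mulrBl hh !mulr_algl mulr_algr opprK subrKA.
by rewrite scalerA -expr2 scalerDl scale1r.
Qed.

(** Multiply by t1 + h1 on the left and by t1 - h4 on the right, then cancel t1^2 + 1. *)
Lemma closes_shift h1 h2 h3 h4 h5 h6 (t1 t2 t3 : R) :
  line h1 -> line h4 ->
  closes h1 h2 h3 h4 h5 h6 t1 t2 t3 -> closes h2 h3 h4 h5 h6 h1 t2 t3 t1.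
Proof.
move=> l1 l4; rewrite /closes -!mulrA => E.
have := congr1 (fun x => (t1%:A + h1) * x * (t1%:A - h4)) E.
rewrite /= !mulrA line_rot_mul // -!mulrA line_rot_mul // !mulr_algl !mulr_algr.
by rewrite -!scalerAr => /(scalerI (sqr_add1_neq0 _)).
Qed.

(** Put A = (t3 + h6)(t2 + h5) and B = (t2 - h2)(t3 - h3). The closure equation minus its shift is
    (A - B) h4 - h1 (A - B): t1 has dropped out, and A - B is affine because t2 t3 cancels. *)
Lemma closes_affine h1 h2 h3 h4 h5 h6 (t1 t2 t3 : R) :
  line h1 -> line h4 -> closes h1 h2 h3 h4 h5 h6 t1 t2 t3 ->
  t3 *: ((h2 + h5) * h4 - h1 * (h2 + h5)) +
  t2 *: ((h3 + h6) * h4 - h1 * (h3 + h6)) +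
  ((h6 * h5 - h2 * h3) * h4 - h1 * (h6 * h5 - h2 * h3)) = 0.
Proof.
move=> l1 l4 E; have := closes_shift l1 l4 E; move: E; rewrite /closes.
move=> /esym/eqP; rewrite -subr_eq0 => /eqP E1.
move=> /esym/eqP; rewrite -subr_eq0 => /eqP E2.
transitivity (0 - 0 : dquat R); last exact: subrr.
rewrite -{1}E1 -E2 => {E1 E2}.
case: h1 h2 h3 h4 h5 h6 l1 l4 => [[????] [????]] [[????] [????]] [[????] [????]]
 [[????] [????]] [[????] [????]] [[????] [????]] _ _.
by congr DQuat; congr Quat => /=; ring.
Qed.

(** Multiplying [g] by the inverse square root of the dual number [- g ^+ 2]. *)
Lemma exists_axis g : dconj g = - g -> primal g != 0 ->
  exists2 l, l ^+ 2 = -1 & forall h h', swaps g h h' -> h = l * h' * l^-1.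
Proof.
case: g => [[a x y z] [b u v w]] gN p0.
have a0 : a = 0 by have /= := congr1 (fun h => q1 (primal h)) gN; lra.
have b0 : b = 0 by have /= := congr1 (fun h => q1 (dualpart h)) gN; lra.
subst a b.
have N0 : 0 < x ^+ 2 + y ^+ 2 + z ^+ 2.
  rewrite lt_def !addr_ge0 ?sqr_ge0 // andbT.
  apply: contra_neq p0 => e.
  by have [-> [-> ->]] : x = 0 /\ y = 0 /\ z = 0 by (repeat split); nra.
set N := _ + _ in N0; pose s := Num.sqrt N.
have s0 : s != 0 by rewrite sqrtr_eq0 -ltNge.
have sN : s ^+ 2 = x ^+ 2 + y ^+ 2 + z ^+ 2 by rewrite sqr_sqrtr // ltW.
set g := DQuat _ _.
(* With m = xu + yv + zw, - g ^+ 2 is s^2 + 2 eps m, whose inverse square root is 1/s - eps m /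
   s^3. *)
pose d := - (x * u + y * v + z * w) / s ^+ 3.
pose K := DQuat (s^-1%:A) d%:A.
have ll : (K * g) * (K * g) = -1.
  congr DQuat; congr Quat => /=; rewrite /d; try by field.
    transitivity (- ((x ^+ 2 + y ^+ 2 + z ^+ 2) / s ^+ 2)); first by field.
    by rewrite -sN divff // expf_neq0.
  transitivity (2 * (x * u + y * v + z * w) *
    (x ^+ 2 + y ^+ 2 + z ^+ 2 - s ^+ 2) / s ^+ 4); first by field.
  by rewrite sN subrr mulr0 mul0r oppr0.
have un : K * g \is a GRing.unit.
  by apply/unitrP; exists (- (K * g)); rewrite mulNr mulrN ll opprK.
exists (K * g) => // h h' [e _].
have -> : K * g * h' = h * (K * g).
  by rewrite -mulrA e mulrA dual_scalar_comm mulrA.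
by rewrite mulrK.
Qed.

(** The cross product is orthogonal to both vectors, so lying in their span makes it zero.
    Lagrange's identity then gives scalar product 1 or -1, and the difference or the sum of the
    vectors has norm 0. *)
Lemma unit_vectors_parallel (x y z x' y' z' s t : R) :
  x ^+ 2 + y ^+ 2 + z ^+ 2 = 1 -> x' ^+ 2 + y' ^+ 2 + z' ^+ 2 = 1 ->
  s * x + t * x' = y * z' - z * y' -> s * y + t * y' = z * x' - x * z' ->
  s * z + t * z' = x * y' - y * x' ->
  [/\ x = x', y = y' & z = z'] \/ [/\ x = - x', y = - y' & z = - z'].
Proof.
move=> n n' ex ey ez.
have c0 : (y * z' - z * y') ^+ 2 + (z * x' - x * z') ^+ 2 + (x * y' - y * x') ^+ 2 = 0.
  transitivity ((y * z' - z * y') * (s * x + t * x') +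
    (z * x' - x * z') * (s * y + t * y') + (x * y' - y * x') * (s * z + t * z')).
    by rewrite ex ey ez; ring.
  by ring.
have : (x * x' + y * y' + z * z' - 1) * (x * x' + y * y' + z * z' + 1) = 0.
  transitivity ((x ^+ 2 + y ^+ 2 + z ^+ 2) * (x' ^+ 2 + y' ^+ 2 + z' ^+ 2) - 1 -
   ((y * z' - z * y') ^+ 2 + (z * x' - x * z') ^+ 2 + (x * y' - y * x') ^+ 2)).
    by ring.
  by rewrite c0 n n'; ring.
move=> /eqP; rewrite mulf_eq0 subr_eq0 addr_eq0 => /orP[] /eqP e; [left|right].
  have e0 : (x - x') ^+ 2 + (y - y') ^+ 2 + (z - z') ^+ 2 = 0.
    by transitivity (x ^+ 2 + y ^+ 2 + z ^+ 2 + (x' ^+ 2 + y' ^+ 2 + z' ^+ 2) -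
      2 * (x * x' + y * y' + z * z')); [ring | rewrite n n' e; ring].
  have h1 := sqr_ge0 (x - x'); have h2 := sqr_ge0 (y - y').
  have h3 := sqr_ge0 (z - z').
  by split; apply/eqP; rewrite -subr_eq0 -sqrf_eq0; apply/eqP; lra.
have e0 : (x + x') ^+ 2 + (y + y') ^+ 2 + (z + z') ^+ 2 = 0.
  by transitivity (x ^+ 2 + y ^+ 2 + z ^+ 2 + (x' ^+ 2 + y' ^+ 2 + z' ^+ 2) +
    2 * (x * x' + y * y' + z * z')); [ring | rewrite n n' e; ring].
have h1 := sqr_ge0 (x + x'); have h2 := sqr_ge0 (y + y').
have h3 := sqr_ge0 (z + z').
by split; apply/eqP; rewrite -addr_eq0 -sqrf_eq0; apply/eqP; lra.
Qed.

Lemma line_coords h : line h -> exists x y z u v w : R,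
  h = DQuat (Quat 0 x y z) (Quat 0 u v w) /\ x ^+ 2 + y ^+ 2 + z ^+ 2 = 1.
Proof.
case: h => [[a x y z] [b u v w]] [hh hN].
have a0 : a = 0 by have /= := congr1 (fun h => q1 (primal h)) hN; lra.
have b0 : b = 0 by have /= := congr1 (fun h => q1 (dualpart h)) hN; lra.
exists x, y, z, u, v, w; rewrite a0 b0; split=> //.
by have /= := congr1 (fun h => q1 (primal h)) hh; rewrite a0; lra.
Qed.

(** For primal directions v of h and v' of h', the primal vector part of x is s v + t v' - v × v',
    so [unit_vectors_parallel] applies. *)
Lemma parallel_of_product h h' (s t : R) : line h -> line h' ->
  let x := (s%:A + h') * (t%:A + h) in primal (x - dconj x) = 0 -> parallel h h'.
Proof.
move=> /line_coords[x [y [z [u [v [w [-> n]]]]]]].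
move=> /line_coords[x' [y' [z' [u' [v' [w' [-> n']]]]]]] X e.
have /= ex := congr1 (@qi R) e; have /= ey := congr1 (@qj R) e.
have /= ez := congr1 (@qk R) e.
have [||||] := @unit_vectors_parallel x y z x' y' z' s t n n'; try lra.
  by case=> -> -> ->; left.
by case=> -> -> ->; right; congr Quat; rewrite /= oppr0.
Qed.

Lemma swap_third_pair h1 h2 h3 h4 h5 h6 g (t1 t2 t3 : R) :
  line h1 -> line h2 -> line h3 -> line h4 -> line h5 -> line h6 ->
  closes h1 h2 h3 h4 h5 h6 t1 t2 t3 ->
  dconj g = - g -> primal g != 0 ->
  swaps g h2 h5 -> swaps g h3 h6 -> g * (h1 + h4) = (h1 + h4) * g ->
  swaps g h1 h4 \/ [/\ parallel h1 h4, parallel h2 h3 & parallel h5 h6].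
Proof.
move=> [l1 c1] [l2 c2] [l3 c3] [l4 c4] [l5 c5] [l6 c6] E gN g0 [s25 s25'] [s36 s36'] gC.
pose X := g * h4 - h1 * g.
have XY : X = h4 * g - g * h1.
  apply/eqP; rewrite subr_eq addrAC eq_sym subr_eq addrC -mulrDl -gC mulrDr.
  by rewrite addrC.
(* All factors are pure, so conjugation sends g h4 - h1 g to h4 g - g h1, which is X again because g
   commutes with h1 + h4. *)
have Xc : dconj X = X.
  by rewrite {1}/X dconjB !dconjM gN c1 c4 !mulrNN -XY.
have [a [b XE]] := dconj_fixed two_neq0 Xc.
have XC x : X * x = x * X by rewrite XE dual_scalar_comm.
have [X0|X0] := eqVneq X 0.
  left; split; apply/eqP; rewrite -subr_eq0 -/X ?X0 //.
  by rewrite -oppr_eq0 opprB -XY X0.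
right.
have Xmul0 x : X * x = 0 -> primal x = 0.
  by rewrite XE; apply: dual_scalar_mul_eq0; rewrite -XE.
have [s14 s14'] := swaps_sum (conj l1 c1) (conj l4 c4).
(* Moving h1 + h4 through both terms of X shows that (h1 + h4) X = - X (h1 + h4); as X is central, 2
   X (h1 + h4) = 0. *)
have p14 : primal (h1 + h4) = 0.
  have e : X * (h1 + h4) = - (X * (h1 + h4)).
    rewrite {1}XC {1}/X mulrBr !mulrA -gC s14' -[g * _ * h4]mulrA s14 -!mulrA -gC.
    by rewrite !mulrA -mulrBl -[in RHS]mulNr XY opprB.
  apply: Xmul0; apply: (scalerI two_neq0).
  by rewrite scaler0 scaler_nat mulr2n {2}e subrr.
pose As := (t3%:A + h3) * (t2%:A + h2).
have pA : primal (As - dconj As) = 0.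
  apply: Xmul0.
  pose B := (t1%:A - h1) * (t2%:A - h2) * (t3%:A - h3).
  pose Bc := As * (t1%:A + h1).
  have rotN (t : R) h : dconj h = - h -> dconj (t%:A - h) = t%:A + h.
    by move=> hN; rewrite dconjB hN dconj_alg opprK.
  have BcE : dconj B = Bc by rewrite !dconjM !rotN // mulrA.
  have BB : dconj Bc = B by rewrite -BcE dconjK.
  have rotS (t : R) h h' : g * h' = h * g -> g * (t%:A + h') = (t%:A + h) * g.
    by move=> e; rewrite mulrDr mulrDl e mulr_algl mulr_algr.
  (* The closure equation rewrites B, and g then passes through the factors of pairs 3 and 2. The
     left side equals its own conjugate, so As X does too, which makes X kill As - dconj As. *)
  have D : g * B - Bc * g = As * X.
    rewrite /B E !mulrA (rotS _ h3) // -[_ * g * _]mulrA (rotS _ h2) //.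
    rewrite !mulrA -/As -[As * g * _]mulrA -[Bc * g]mulrA -mulrBr.
    congr (_ * _); rewrite /X mulrDr mulrDl mulr_algl mulr_algr.
    by rewrite opprD addrACA subrr add0r.
  have : dconj (As * X) = As * X.
    by rewrite -D dconjB (dconjM g) (dconjM Bc) BB BcE gN mulrN mulNr opprK addrC.
  by rewrite dconjM Xc -XC => e; rewrite mulrBr e subrr.
have p23 : parallel h2 h3.
  by apply: (parallel_of_product (conj l2 c2) (conj l3 c3) pA).
split=> //.
  by right; apply/eqP; rewrite -addr_eq0; apply/eqP.
(* Conjugation by the primal part of g carries h5, h6 to h2, h3 on primal parts, which transports
   the parallelism. *)
have ug : primal g \is a GRing.unit by have := primal_unit g0.
have /= e5 := congr1 (@primal R) s25.
have /= e6 := congr1 (@primal R) s36.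
case: p23 => e; [left|right]; apply: (mulrI ug).
  by rewrite e5 e6 e.
by rewrite mulrN e5 e6 e mulNr.
Qed.

(** With v = (x, y, z), v' = (x', y', z') and n = v × v', the witness is (m (v' × n) + m' (n × v)) /
    |n|^2. *)
Lemma exists_vector_with_products (x y z x' y' z' m m' : R) :
  let n1 := y * z' - z * y' in let n2 := z * x' - x * z' in
  let n3 := x * y' - y * x' in
  n1 ^+ 2 + n2 ^+ 2 + n3 ^+ 2 != 0 ->
  exists a b c : R, a * x + b * y + c * z = m /\ a * x' + b * y' + c * z' = m'.
Proof.
move=> n1 n2 n3 N0; set N := _ + _ in N0.
exists ((m * (y' * n3 - z' * n2) + m' * (n2 * z - n3 * y)) / N),
  ((m * (z' * n1 - x' * n3) + m' * (n3 * x - n1 * z)) / N),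
  ((m * (x' * n2 - y' * n1) + m' * (n1 * y - n2 * x)) / N).
by split; rewrite /N /n1 /n2 /n3 in N0 *; field.
Qed.

(** The hypotheses are the coordinates of the swap condition for opposite directions: n is
    orthogonal to the direction, the moment (a, b, c) has the right product with it, and n is
    proportional to the sum of the two moments. *)
Lemma swaps_antiparallel (x y z u v w u' v' w' n1 n2 n3 a b c : R) :
  n1 * x + n2 * y + n3 * z = 0 ->
  2 * (a * x + b * y + c * z) = n1 * (u' - u) + n2 * (v' - v) + n3 * (w' - w) ->
  n2 * (w + w') = n3 * (v + v') -> n3 * (u + u') = n1 * (w + w') ->
  n1 * (v + v') = n2 * (u + u') ->
  swaps (DQuat (Quat 0 n1 n2 n3) (Quat 0 a b c))
    (DQuat (Quat 0 x y z) (Quat 0 u v w))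
    (DQuat (Quat 0 (- x) (- y) (- z)) (Quat 0 u' v' w')).
Proof.
by move=> *; split; congr DQuat; congr Quat => /=; lra.
Qed.

Lemma swaps_dual_orthogonal (x y z u v w u' v' w' a b c : R) :
  let h := DQuat (Quat 0 x y z) (Quat 0 u v w) in
  let h' := DQuat (Quat 0 (- x) (- y) (- z)) (Quat 0 u' v' w') in
  swaps (DQuat 0 (Quat 0 a b c)) h h' -> a * x + b * y + c * z = 0.
Proof. by move=> h h' [e _]; have /= := congr1 (fun h => q1 (dualpart h)) e; lra. Qed.

(** The conclusion says n × (a, b, c) = 0 for n = v × v'; it is the expansion of the triple product
    (v × v') × (a, b, c). *)
Lemma cross_of_orthogonal (x y z x' y' z' a b c : R) :
  let n1 := y * z' - z * y' in let n2 := z * x' - x * z' in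
  let n3 := x * y' - y * x' in
  a * x + b * y + c * z = 0 -> a * x' + b * y' + c * z' = 0 ->
  [/\ n2 * c = n3 * b, n3 * a = n1 * c & n1 * b = n2 * a].
Proof.
move=> n1 n2 n3 e e'.
have comb (p q : R) :
    p * (a * x + b * y + c * z) - q * (a * x' + b * y' + c * z') = 0.
  by rewrite e e' !mulr0 subrr.
by split; apply/eqP; rewrite -subr_eq0; apply/eqP; [rewrite -(comb x' x)
  | rewrite -(comb y' y) | rewrite -(comb z' z)]; rewrite /n1 /n2 /n3; ring.
Qed.

Definition common_axis h1 h2 h3 h4 h5 h6 := exists g,
  [/\ dconj g = - g, primal g != 0, swaps g h1 h4, swaps g h2 h5 & swaps g h3 h6].

Lemma swaps_comm g h h' : swaps g h h' -> g * (h + h') = (h + h') * g.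
Proof. by move=> [e e']; rewrite mulrDr mulrDl e e' addrC. Qed.

Lemma sum_antiparallel h h' : line h -> line h' -> primal (h + h') = 0 ->
  exists x y z u v w u' v' w' : R,
  [/\ h = DQuat (Quat 0 x y z) (Quat 0 u v w),
      h' = DQuat (Quat 0 (- x) (- y) (- z)) (Quat 0 u' v' w'),
      h + h' = DQuat 0 (Quat 0 (u + u') (v + v') (w + w')) &
      x ^+ 2 + y ^+ 2 + z ^+ 2 = 1].
Proof.
move=> /line_coords[x [y [z [u [v [w [-> n]]]]]]].
move=> /line_coords[x' [y' [z' [u' [v' [w' [-> _]]]]]]] e.
have /= /eqP := congr1 (@qi R) e; rewrite addrC addr_eq0 => /eqP ->.
have /= /eqP := congr1 (@qj R) e; rewrite addrC addr_eq0 => /eqP ->.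
have /= /eqP := congr1 (@qk R) e; rewrite addrC addr_eq0 => /eqP ->.
exists x, y, z, u, v, w, u', v', w'; split=> //.
by congr DQuat; congr Quat => /=; ring.
Qed.

Lemma two_pairs_swapped h1 h2 h3 h4 h5 h6 (t1 t2 t3 : R) :
  line h1 -> line h2 -> line h3 -> line h4 -> line h5 -> line h6 ->
  closes h1 h2 h3 h4 h5 h6 t1 t2 t3 ->
  swaps (h1 + h4) h2 h5 -> swaps (h3 + h6) h2 h5 ->
  swaps (h1 + h4) h3 h6 -> swaps (h2 + h5) h3 h6 ->
  common_axis h1 h2 h3 h4 h5 h6 \/
  [/\ parallel h1 h4, parallel h2 h3 & parallel h5 h6].
Proof.
move=> l1 l2 l3 l4 l5 l6 E s12 s32 s13 s23.
have s22 := swaps_sum l2 l5; have s33 := swaps_sum l3 l6.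
have third g : dconj g = - g -> primal g != 0 -> swaps g h2 h5 -> swaps g h3 h6 ->
    g * (h1 + h4) = (h1 + h4) * g ->
    common_axis h1 h2 h3 h4 h5 h6 \/
    [/\ parallel h1 h4, parallel h2 h3 & parallel h5 h6].
  move=> gN g0 s2 s3 gC.
  have [s1|] := swap_third_pair l1 l2 l3 l4 l5 l6 E gN g0 s2 s3 gC; last by right.
  by left; exists g.
have dN h h' : line h -> line h' -> dconj (h + h') = - (h + h').
  by move=> [_ hN] [_ hN']; rewrite dconjD hN hN' opprD.
have [p1|p1] := eqVneq (primal (h1 + h4)) 0; last first.
  by apply: (third (h1 + h4)) => //; exact: dN.
have [p2|p2] := eqVneq (primal (h2 + h5)) 0; last first.
  by apply: (third (h2 + h5)) => //; [exact: dN | rewrite (swaps_comm s12)].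
have [p3|p3] := eqVneq (primal (h3 + h6)) 0; last first.
  by apply: (third (h3 + h6)) => //; [exact: dN | rewrite (swaps_comm s13)].
have p14 : parallel h1 h4.
  by right; apply/eqP; rewrite -addr_eq0; apply/eqP.
move: s12 s32 s13 s23 s22 s33 third.
have [x [y [z [u [v [w [u2 [v2 [w2 [-> -> -> n]]]]]]]]]] := sum_antiparallel l2 l5 p2.
have [x' [y' [z' [u' [v' [w' [u3 [v3 [w3 [-> -> -> n']]]]]]]]]] :=
  sum_antiparallel l3 l6 p3.
have [x1 [y1 [z1 [a1 [b1 [c1 [a4 [b4 [c4 [_ _ -> _]]]]]]]]]] :=
  sum_antiparallel l1 l4 p1.
move=> /swaps_dual_orthogonal o12 /swaps_dual_orthogonal o32.
move=> /swaps_dual_orthogonal o13 /swaps_dual_orthogonal o23.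
move=> /swaps_dual_orthogonal o22 /swaps_dual_orthogonal o33 third.
set n1 := y * z' - z * y'; set n2 := z * x' - x * z'; set n3 := x * y' - y * x'.
(* If the directions of h2 and h3 have zero cross product, h2 and h3 are parallel, and so are h5 and
   h6, whose directions are their opposites. *)
have [c0|c0] := eqVneq (n1 ^+ 2 + n2 ^+ 2 + n3 ^+ 2) 0.
  have hn1 := sqr_ge0 n1; have hn2 := sqr_ge0 n2; have hn3 := sqr_ge0 n3.
  have n10 : n1 = 0 by apply/eqP; rewrite -sqrf_eq0; apply/eqP; lra.
  have n20 : n2 = 0 by apply/eqP; rewrite -sqrf_eq0; apply/eqP; lra.
  have n30 : n3 = 0 by apply/eqP; rewrite -sqrf_eq0; apply/eqP; lra.
  right; have [||||] := @unit_vectors_parallel x y z x' y' z' 0 0 n n'.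
  1-3: by rewrite !mul0r addr0.
    by case=> -> -> ->; split=> //; left.
  case=> -> -> ->; split=> //; right; congr Quat; by rewrite /= ?oppr0.
(* The common normal n is the primal part of the swapping element; its moment is chosen to meet the
   scalar swap conditions of pairs 2 and 3 together. *)
have [a [b [c [e e']]]] := @exists_vector_with_products x y z x' y' z'
  ((n1 * (u2 - u) + n2 * (v2 - v) + n3 * (w2 - w)) / 2)
  ((n1 * (u3 - u') + n2 * (v3 - v') + n3 * (w3 - w')) / 2) c0.
(* The moments of the three sums are orthogonal to the directions of h2 and h3, hence proportional
   to n. This gives the remaining swap conditions and the commutation with h1 + h4. *)
have [f2 f2' f2''] := cross_of_orthogonal o22 o23.
have [f3 f3' f3''] := cross_of_orthogonal o32 o33.
have [f1 f1' f1''] := cross_of_orthogonal o12 o13.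
apply: (third (DQuat (Quat 0 n1 n2 n3) (Quat 0 a b c))).
- by congr DQuat; congr Quat; rewrite /= oppr0.
- by apply: contra_neq c0 => -[-> -> ->]; ring.
- apply: swaps_antiparallel => //; rewrite ?e ?/n1 ?/n2 ?/n3; by [ring|field].
- apply: swaps_antiparallel => //; rewrite ?e' ?/n1 ?/n2 ?/n3; by [ring|field].
- move: f1 f1' f1''; rewrite -/n1 -/n2 -/n3 => f1 f1' f1''; clearbody n1 n2 n3.
  by congr DQuat; congr Quat => /=; lra.
Qed.
End RealAlgebra.

(** * Real coordinates and minors of a matrix of rank at most 3 *)

Lemma dcoordE (F : fieldType) (x : dquat F) k : dcoord x 0 k =
  [:: q1 (primal x); qi (primal x); qj (primal x); qk (primal x);
      q1 (dualpart x); qi (dualpart x); qj (dualpart x); qk (dualpart x)]`_k.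
Proof. by rewrite mxE. Qed.

Lemma dcoordD (F : fieldType) (x y : dquat F) k :
  dcoord (x + y) 0 k = dcoord x 0 k + dcoord y 0 k.
Proof. by rewrite !dcoordE; case: k => [[|[|[|[|[|[|[|[|//]]]]]]]] ?]. Qed.

Lemma dcoordZ (F : fieldType) a (x : dquat F) k :
  dcoord (a *: x) 0 k = a * dcoord x 0 k.
Proof. by rewrite !dcoordE; case: k => [[|[|[|[|[|[|[|[|//]]]]]]]] ?]. Qed.

Lemma dcoord0 (F : fieldType) k : dcoord (0 : dquat F) 0 k = 0.
Proof. by rewrite -(scale0r 0) dcoordZ mul0r. Qed.

Lemma dcoord_inj (F : fieldType) (x y : dquat F) :
  (forall k, dcoord x 0 k = dcoord y 0 k) -> x = y.
Proof.
move=> e.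
have c n (ltn8 : (n < 8)%N) := e (Ordinal ltn8).
move: (c 0 isT) (c 1 isT) (c 2 isT) (c 3 isT) (c 4 isT) (c 5 isT) (c 6 isT) (c 7 isT).
rewrite !dcoordE; case: x y {e c} => [[????][????]] [[????][????]] /=.
by do 8!move=> ->.
Qed.

(** Columns i, j, x, y give a, b, u, v a block triangular shape with u, v diagonal on x, y. A
    nonzero minor of a, b on i, j would make the four rows independent. *)
Lemma minor_of_rank_le3 (F : fieldType) m n (M : 'M[F]_(m, n)) (a b u v : 'rV_n)
    (i j x y : 'I_n) : (\rank M <= 3)%N ->
  (a <= M)%MS -> (b <= M)%MS -> (u <= M)%MS -> (v <= M)%MS ->
  u 0 i = 0 -> u 0 j = 0 -> v 0 i = 0 -> v 0 j = 0 ->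
  u 0 x != 0 -> v 0 x = 0 -> u 0 y = 0 -> v 0 y != 0 ->
  a 0 i * b 0 j = a 0 j * b 0 i.
Proof.
move=> r3 aM bM uM vM ui uj vi vj ux vx uy vy.
pose N : 'M[F]_(4, n) := \matrix_(r < 4) [:: a; b; u; v]`_r.
have NM : (N <= M)%MS.
  apply/row_subP => r; rewrite rowK.
  by case: r => [[|[|[|[|//]]]] ?] /=.
have : ~~ row_free N.
  by rewrite /row_free neq_ltn ltnS (leq_trans (mxrankS NM)).
rewrite -kermx_eq0 => /rowV0Pn[c /sub_kermxP cN c0].
have cE l : c 0 0 * a 0 l + c 0 1 * b 0 l + c 0 2 * u 0 l + c 0 3 * v 0 l = 0.
  have := congr1 (fun A : 'rV_n => A 0 l) cN.
  rewrite !mxE !big_ord_recr big_ord0 /= add0r !mxE /= => <-.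
  by congr (_ * _ + _ * _ + _ * _ + _ * _); congr (c _ _); apply: val_inj.
apply/eqP; apply: contraNT c0 => d0.
have e1 := cE i; have e2 := cE j; have e3 := cE x; have e4 := cE y.
rewrite ui vi !mulr0 !addr0 in e1; rewrite uj vj !mulr0 !addr0 in e2.
rewrite vx in e3; rewrite uy in e4.
have {}d0 : a 0 i * b 0 j - a 0 j * b 0 i != 0 by rewrite subr_eq0.
have c00 : c 0 0 = 0.
  apply: (mulIf d0); rewrite mul0r.
  transitivity ((c 0 0 * a 0 i + c 0 1 * b 0 i) * b 0 j -
    (c 0 0 * a 0 j + c 0 1 * b 0 j) * b 0 i); first by ring.
  by rewrite e1 e2; ring.
have c01 : c 0 1 = 0.
  apply: (mulIf d0); rewrite mul0r.
  transitivity ((c 0 0 * a 0 j + c 0 1 * b 0 j) * a 0 i -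
    (c 0 0 * a 0 i + c 0 1 * b 0 i) * a 0 j); first by ring.
  by rewrite e1 e2; ring.
rewrite c00 c01 !mul0r !add0r !mulr0 ?addr0 in e3 e4.
have c02 : c 0 2 = 0 by apply: (mulIf ux); rewrite mul0r.
rewrite ?add0r in e4.
have c03 : c 0 3 = 0 by apply: (mulIf vy); rewrite mul0r.
apply/eqP/rowP => l; rewrite [RHS]mxE.
case: l => [[|[|[|[|//]]]] hl];
  [rewrite -[RHS]c00|rewrite -[RHS]c01|rewrite -[RHS]c02|rewrite -[RHS]c03];
  by congr (c _ _); apply: val_inj.
Qed.

(** * Consequences of the affine equations along a nonconstant curve *)

Section Curve.
Variable R : rcfType.
Implicit Types (h g : dquat R) (K : R -> R -> R -> Prop).

(** One point must avoid three prescribed values at once; irreducibility of the component provides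
    this strong form. *)
Definition nonconstant K := forall x1 x2 x3, exists t1 t2 t3,
  [/\ K t1 t2 t3, t1 != x1, t2 != x2 & t3 != x3].

(** The remaining condition [swaps (h1 + h4) h1 h4] is automatic for lines. *)
Definition pair_swapped h1 h2 h3 h4 h5 h6 :=
  swaps (h2 + h5) h1 h4 /\ swaps (h3 + h6) h1 h4.

Definition swap_defect k g h h' : R := dcoord (g * h' - h * g) 0 k.

Lemma swap_defect_eq0 g h h' : (forall k, swap_defect k g h h' = 0) -> g * h' = h * g.
Proof.
move=> e; apply/eqP; rewrite -subr_eq0; apply/eqP; apply: dcoord_inj => k.
by rewrite dcoord0; exact: e.
Qed.

Lemma defect_form h1 h2 h3 h4 h5 h6 K k : line h1 -> line h4 ->
  (forall t1 t2 t3, K t1 t2 t3 -> closes h1 h2 h3 h4 h5 h6 t1 t2 t3) ->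
  exists c, forall t1 t2 t3, K t1 t2 t3 ->
    t3 * swap_defect k (h2 + h5) h1 h4 + t2 * swap_defect k (h3 + h6) h1 h4 + c = 0.
Proof.
move=> l1 l4 E.
exists (dcoord ((h6 * h5 - h2 * h3) * h4 - h1 * (h6 * h5 - h2 * h3)) 0 k).
move=> t1 t2 t3 /E/(closes_affine l1 l4)/(congr1 (fun x => dcoord x 0 k)).
by rewrite /= 2!dcoordD 2!dcoordZ dcoord0.
Qed.

Lemma defect_neq0 h1 h2 h3 h4 h5 h6 K k : line h1 -> line h4 -> nonconstant K ->
  (forall t1 t2 t3, K t1 t2 t3 -> closes h1 h2 h3 h4 h5 h6 t1 t2 t3) ->
  (swap_defect k (h2 + h5) h1 h4 == 0) = (swap_defect k (h3 + h6) h1 h4 == 0).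
Proof.
move=> l1 l4 nc E; have [c] := defect_form k l1 l4 E.
set a := swap_defect _ _ _ _; set b := swap_defect _ _ _ _ => H.
(* These are the values the affine equation would force on t2 or t3 if only one coefficient were
   nonzero. *)
have [t1 [t2 [t3 [/H Kt _ t2x t3x]]]] := nc 0 (- c / b) (- c / a).
apply/eqP/eqP => e0; rewrite e0 mulr0 ?addr0 ?add0r in Kt.
  apply: contra_neq_eq t2x => b0.
  by apply: (mulIf b0); rewrite divfK //; apply/eqP; rewrite -addr_eq0 Kt.
apply: contra_neq_eq t3x => a0.
by apply: (mulIf a0); rewrite divfK //; apply/eqP; rewrite -addr_eq0 Kt.
Qed.

Lemma closes_shift3 h1 h2 h3 h4 h5 h6 (t1 t2 t3 : R) :
  line h1 -> line h2 -> line h3 -> line h4 -> line h5 -> line h6 ->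
  closes h1 h2 h3 h4 h5 h6 t1 t2 t3 -> closes h4 h5 h6 h1 h2 h3 t1 t2 t3.
Proof. by move=> *; do 3!apply: closes_shift => //. Qed.

(** In each coordinate the defects of the two sums vanish together, for either order of the pair; so
    a nonzero defect of one sum comes with a nonzero defect of the other. *)
Lemma not_pair_swapped h1 h2 h3 h4 h5 h6 K :
  line h1 -> line h2 -> line h3 -> line h4 -> line h5 -> line h6 ->
  nonconstant K ->
  (forall t1 t2 t3, K t1 t2 t3 -> closes h1 h2 h3 h4 h5 h6 t1 t2 t3) ->
  ~ pair_swapped h1 h2 h3 h4 h5 h6 ->
  exists k,
   (swap_defect k (h2 + h5) h1 h4 != 0 /\ swap_defect k (h3 + h6) h1 h4 != 0) \/
   (swap_defect k (h2 + h5) h4 h1 != 0 /\ swap_defect k (h3 + h6) h4 h1 != 0).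
Proof.
move=> l1 l2 l3 l4 l5 l6 nc E; apply: contra_notP => /forallNP H.
have d1 k := defect_neq0 k l1 l4 nc E.
have E4 t1 t2 t3 (Kt : K t1 t2 t3) := closes_shift3 l1 l2 l3 l4 l5 l6 (E _ _ _ Kt).
have d4 k := defect_neq0 k l4 l1 nc E4.
have {}H k : (swap_defect k (h2 + h5) h1 h4 = 0 /\ swap_defect k (h3 + h6) h1 h4 = 0) /\
   (swap_defect k (h2 + h5) h4 h1 = 0 /\ swap_defect k (h3 + h6) h4 h1 = 0).
  have /not_orP[] := H k; rewrite d1 [h2 + h5]addrC d4 [h6 + h3]addrC.
  move=> /not_andP e1 /not_andP e2.
  have /eqP f1 : swap_defect k (h3 + h6) h1 h4 == 0.
    by apply: contraT => ne; case: e1.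
  have /eqP f2 : swap_defect k (h3 + h6) h4 h1 == 0.
    by apply: contraT => ne; case: e2.
  rewrite f1 f2; do !split=> //; apply/eqP.
    by rewrite [h5 + h2]addrC d1 f1.
  by rewrite d4 addrC f2.
by split; split; apply: swap_defect_eq0 => k; case: (H k) => [[? ?] [? ?]].
Qed.

Lemma swapsZ (a : R) g h h' : swaps g h h' -> swaps (a *: g) h h'.
Proof. by move=> [e e']; split; rewrite -scalerAl -scalerAr ?e ?e'. Qed.

Lemma proportional_swaps g g' h h' : swaps g h h' -> g != 0 ->
  (forall k k', dcoord g 0 k * dcoord g' 0 k' = dcoord g 0 k' * dcoord g' 0 k) ->
  swaps g' h h'.
Proof.
move=> s g0 e.
have [k gk] : exists k, dcoord g 0 k != 0.
  apply/not_existsP; apply: contra_neq_not g0 => gk; apply: dcoord_inj => k.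
  rewrite dcoord0; apply/eqP; apply: contraT => /gk //.
have -> : g' = (dcoord g' 0 k / dcoord g 0 k) *: g.
  apply: dcoord_inj => l; rewrite dcoordZ; apply: (mulfI gk).
  by rewrite e mulrA mulrCA divff // mulr1 mulrC.
exact: swapsZ.
Qed.

(** The point (t1, t2, t3) of K becomes (t2, t3, t1), matching [closes_shift]. *)
Definition rotate3 K t1 t2 t3 := K t3 t1 t2 : Prop.

Lemma nonconstant_rotate3 K : nonconstant K -> nonconstant (rotate3 K).
Proof.
move=> nc x1 x2 x3; have [t1 [t2 [t3 [Kt n1 n2 n3]]]] := nc x3 x1 x2.
by exists t2, t3, t1.
Qed.

Lemma closes_rotate3 h1 h2 h3 h4 h5 h6 K : line h1 -> line h4 ->
  (forall t1 t2 t3, K t1 t2 t3 -> closes h1 h2 h3 h4 h5 h6 t1 t2 t3) ->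
  (forall t1 t2 t3, rotate3 K t1 t2 t3 -> closes h2 h3 h4 h5 h6 h1 t1 t2 t3).
Proof. by move=> l1 l4 E t1 t2 t3 /E; exact: closes_shift. Qed.

(** If h1 + h4 is nonzero, the other sums are real multiples of it and it swaps its own pair. If it
    is zero, it swaps pair 2 trivially, and its vanishing defects force those of h3 + h6 to
    vanish. *)
Lemma swapped_of_minors h1 h2 h3 h4 h5 h6 K :
  line h1 -> line h2 -> line h3 -> line h4 -> line h5 -> line h6 ->
  nonconstant K ->
  (forall t1 t2 t3, K t1 t2 t3 -> closes h1 h2 h3 h4 h5 h6 t1 t2 t3) ->
  (forall k k', dcoord (h1 + h4) 0 k * dcoord (h2 + h5) 0 k' =
     dcoord (h1 + h4) 0 k' * dcoord (h2 + h5) 0 k) ->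
  (forall k k', dcoord (h1 + h4) 0 k * dcoord (h3 + h6) 0 k' =
     dcoord (h1 + h4) 0 k' * dcoord (h3 + h6) 0 k) ->
  pair_swapped h1 h2 h3 h4 h5 h6 \/ pair_swapped h2 h3 h4 h5 h6 h1.
Proof.
move=> l1 l2 l3 l4 l5 l6 nc E m12 m13.
have s11 := swaps_sum l1 l4.
have [g10|g10] := eqVneq (h1 + h4) 0; last first.
  by left; split; apply: proportional_swaps s11 g10 _.
right; have s42 : swaps (h4 + h1) h2 h5.
  by rewrite addrC g10; split; rewrite mul0r mulr0.
split=> //.
have nc' := nonconstant_rotate3 nc; have E' := closes_rotate3 l1 l4 E.
have d2 k := defect_neq0 k l2 l5 nc' E'.
have d5 k := defect_neq0 k l5 l2 nc' (fun t1 t2 t3 Kt =>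
  closes_shift3 l2 l3 l4 l5 l6 l1 (E' t1 t2 t3 Kt)).
have defect0 k h h' : swap_defect k (h4 + h1) h h' = 0.
  by rewrite addrC g10 /swap_defect mul0r mulr0 subrr dcoord0.
split; apply: swap_defect_eq0 => k; apply/eqP.
  by rewrite d2 defect0.
by rewrite addrC d5 [h1 + h4]addrC defect0.
Qed.
End Curve.

(** * Closed sets of (P^1)^3 and generic points of irreducible sets *)

Section ZariskiTopology.
Variable F : fieldType.
Implicit Types (t : P1_3 F) (A B Z : set (P1_3 F)).
Local Open Scope classical_set_scope.

Definition is_form (d1 d2 d3 : nat) (f : P1_3 F -> F) :=
  exists c, f = triform_eval (Triform d1 d2 d3 c).

Lemma is_form0 d1 d2 d3 : is_form d1 d2 d3 (fun=> 0).
Proof.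
exists (fun _ _ _ => 0); apply/funext => t; rewrite /triform_eval /=.
by rewrite big1 // => i _; rewrite big1 // => j _; rewrite big1 // => k _; rewrite mul0r.
Qed.

Lemma is_formD d1 d2 d3 f g : is_form d1 d2 d3 f -> is_form d1 d2 d3 g ->
  is_form d1 d2 d3 (fun t => f t + g t).
Proof.
move=> [c ->] [c' ->]; exists (fun i j k => c i j k + c' i j k).
apply/funext => t; rewrite /triform_eval /=.
rewrite -big_split; apply: eq_bigr => i _; rewrite -big_split.
apply: eq_bigr => j _; rewrite -big_split; apply: eq_bigr => k _.
by rewrite mulrDl.
Qed.

Lemma is_form_sum d1 d2 d3 (I : finType) (f : I -> P1_3 F -> F) :
  (forall i, is_form d1 d2 d3 (f i)) ->
  is_form d1 d2 d3 (fun t => \sum_i f i t).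
Proof.
move=> ff.
have -> : (fun t => \sum_i f i t) = \big[(fun f g t => f t + g t)/(fun=> 0)]_i f i.
  by apply/funext => t; elim/big_rec2: _ => // i g x _ ->.
by apply: (big_ind (is_form d1 d2 d3)) => // [|g g']; [exact: is_form0 | exact: is_formD].
Qed.

Lemma is_form_monomial d1 d2 d3 i j k (a : F) :
  (i <= d1)%N -> (j <= d2)%N -> (k <= d3)%N ->
  is_form d1 d2 d3
    (fun t => a * (hmon d1 i t.1.1 * hmon d2 j t.1.2 * hmon d3 k t.2)).
Proof.
move=> id jd kd.
exists (fun i' j' k' => if [&& i' == i, j' == j & k' == k] then a else 0).
apply/funext => t; rewrite /triform_eval /=.
rewrite (bigD1 (inord i)) //= [X in _ + X]big1 ?addr0; last first.
  move=> i' ne; rewrite big1 // => j' _; rewrite big1 // => k' _.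
  rewrite ifF ?mul0r //; apply: contra_neqF ne => /andP[/eqP <- _].
  by rewrite inord_val.
rewrite (bigD1 (inord j)) //= [X in _ + X]big1 ?addr0; last first.
  move=> j' ne; rewrite big1 // => k' _.
  rewrite ifF ?mul0r //; apply: contra_neqF ne => /and3P[_ /eqP <- _].
  by rewrite inord_val.
rewrite (bigD1 (inord k)) //= [X in _ + X]big1 ?addr0; last first.
  move=> k' ne; rewrite ifF ?mul0r //.
  by apply: contra_neqF ne => /and3P[_ _ /eqP <-]; rewrite inord_val.
by rewrite !inordK // !eqxx.
Qed.

Lemma hmonM d d' i i' (a : P1 F) : (i <= d)%N -> (i' <= d')%N ->
  hmon d i a * hmon d' i' a = hmon (d + d') (i + i') a.
Proof.
move=> id id'; rewrite /hmon mulrACA -!exprD; congr (_ * _ ^+ _).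
by rewrite subnDA -addnBAC // addnBA.
Qed.

Lemma is_formM d1 d2 d3 e1 e2 e3 f g : is_form d1 d2 d3 f -> is_form e1 e2 e3 g ->
  is_form (d1 + e1) (d2 + e2) (d3 + e3) (fun t => f t * g t).
Proof.
move=> [c ->] [c' ->].
have -> : (fun t => triform_eval (Triform d1 d2 d3 c) t *
    triform_eval (Triform e1 e2 e3 c') t) =
  fun t => \sum_(i < d1.+1) \sum_(j < d2.+1) \sum_(k < d3.+1)
    \sum_(i' < e1.+1) \sum_(j' < e2.+1) \sum_(k' < e3.+1)
     c i j k * c' i' j' k' * (hmon (d1 + e1) (i + i') t.1.1 *
       hmon (d2 + e2) (j + j') t.1.2 * hmon (d3 + e3) (k + k') t.2).
  apply/funext => t; rewrite /triform_eval /=.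
  do 3!(rewrite mulr_suml; apply: eq_bigr => ? _).
  do 3!(rewrite mulr_sumr; apply: eq_bigr => ? _).
  by rewrite -!hmonM ?leq_ord //; ring.
do 6!(apply: is_form_sum => ?).
by apply: is_form_monomial; rewrite leq_add // leq_ord.
Qed.

(** The union is cut out by all products of an equation of A with an equation of B. *)
Lemma zclosedU A B : zclosed A -> zclosed B -> zclosed (A `|` B).
Proof.
move=> [S ->] [S' ->].
exists [set h | exists f g, [/\ S f, S' g &
  triform_eval h = fun t => triform_eval f t * triform_eval g t]].
apply/seteqP; split => t /=.
  by move=> [H|H] h [f [g [Sf Sg ->]]]; [rewrite (H f) // mul0r | rewrite (H g) // mulr0].
move=> H; have [|/existsNP[f /not_implyP[Sf /eqP f0]]] :=
  pselect (forall f, S f -> triform_eval f t = 0); first by left.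
right=> g Sg.
have isf (f' : triform F) : is_form (tdeg1 f') (tdeg2 f') (tdeg3 f') (triform_eval f').
  by case: f' => a b c d; exists d.
have [c hE] := is_formM (isf f) (isf g).
have := H (Triform (tdeg1 f + tdeg1 g) (tdeg2 f + tdeg2 g) (tdeg3 f + tdeg3 g) c).
rewrite -hE => /(_ _)/eqP; rewrite mulf_eq0 (negPf f0) => e; apply/eqP/e.
by exists f, g.
Qed.

(** This determinant of homogeneous coordinates is the equation of the coordinate fibres below. *)
Lemma hcross_eq0 (a b : P1 F) : hx a * hy b - hy a * hx b = 0 <-> a = b.
Proof.
case: a b => [a|] [b|]; rewrite /= ?mulr1 ?mul1r ?mulr0 ?mul0r.
- by rewrite (rwP eqP) subr_eq0; split => [/eqP->//|[->]].
- by split => // /eqP; rewrite sub0r oppr_eq0 oner_eq0.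
- by split => // /eqP; rewrite subr0 oner_eq0.
- by rewrite subrr.
Qed.

Lemma zclosed_form d1 d2 d3 f : is_form d1 d2 d3 f -> zclosed [set t | f t = 0].
Proof.
move=> [c ->]; exists [set Triform d1 d2 d3 c].
by apply/seteqP; split => t /=; [move=> e _ -> | exact].
Qed.

Lemma zclosed_fiber1 (a : P1 F) : zclosed [set t | t.1.1 = a].
Proof.
have := @is_formD 1 0 0 _ _ (is_form_monomial (hy a) (leqnn 1) (leqnn 0) (leqnn 0))
  (is_form_monomial (- hx a) (leq0n 1) (leqnn 0) (leqnn 0)).
move=> /zclosed_form; congr zclosed; apply/seteqP.
have e t : hy a * (hmon 1 1 t.1.1 * hmon 0 0 t.1.2 * hmon 0 0 t.2) +
  - hx a * (hmon 1 0 t.1.1 * hmon 0 0 t.1.2 * hmon 0 0 t.2) =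
  hx t.1.1 * hy a - hy t.1.1 * hx a by rewrite /hmon subnn !expr0 subn0 !expr1; ring.
by split => t /=; rewrite e => /hcross_eq0.
Qed.

Lemma zclosed_fiber2 (a : P1 F) : zclosed [set t | t.1.2 = a].
Proof.
have := @is_formD 0 1 0 _ _ (is_form_monomial (hy a) (leqnn 0) (leqnn 1) (leqnn 0))
  (is_form_monomial (- hx a) (leqnn 0) (leq0n 1) (leqnn 0)).
move=> /zclosed_form; congr zclosed; apply/seteqP.
have e t : hy a * (hmon 0 0 t.1.1 * hmon 1 1 t.1.2 * hmon 0 0 t.2) +
  - hx a * (hmon 0 0 t.1.1 * hmon 1 0 t.1.2 * hmon 0 0 t.2) =
  hx t.1.2 * hy a - hy t.1.2 * hx a by rewrite /hmon subnn !expr0 subn0 !expr1; ring.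
by split => t /=; rewrite e => /hcross_eq0.
Qed.

Lemma zclosed_fiber3 (a : P1 F) : zclosed [set t | t.2 = a].
Proof.
have := @is_formD 0 0 1 _ _ (is_form_monomial (hy a) (leqnn 0) (leqnn 0) (leqnn 1))
  (is_form_monomial (- hx a) (leqnn 0) (leqnn 0) (leq0n 1)).
move=> /zclosed_form; congr zclosed; apply/seteqP.
have e t : hy a * (hmon 0 0 t.1.1 * hmon 0 0 t.1.2 * hmon 1 1 t.2) +
  - hx a * (hmon 0 0 t.1.1 * hmon 0 0 t.1.2 * hmon 1 0 t.2) =
  hx t.2 * hy a - hy t.2 * hx a by rewrite /hmon subnn !expr0 subn0 !expr1; ring.
by split => t /=; rewrite e => /hcross_eq0.
Qed.

(** Z lies in none of the six fibres over infinity and over the x_i, so by irreducibility it does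
    not lie in their union. *)
Lemma zirreducible_finite_point Z : zirreducible Z ->
  ~ (exists a, forall t, Z t -> t.1.1 = a) ->
  ~ (exists a, forall t, Z t -> t.1.2 = a) ->
  ~ (exists a, forall t, Z t -> t.2 = a) ->
  forall x1 x2 x3 : F, exists t1 t2 t3 : F, [/\ Z (Some t1, Some t2, Some t3),
    t1 != x1, t2 != x2 & t3 != x3].
Proof.
move=> [_ irr] n1 n2 n3 x1 x2 x3.
have fiber A B : zclosed A -> zclosed B -> ~ Z `<=` A -> ~ Z `<=` B -> ~ Z `<=` A `|` B.
  by move=> cA cB nA nB /(irr _ _ cA cB)[].
have f1 a : ~ Z `<=` [set t | t.1.1 = a] by move=> H; apply: n1; exists a.
have f2 a : ~ Z `<=` [set t | t.1.2 = a] by move=> H; apply: n2; exists a.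
have f3 a : ~ Z `<=` [set t | t.2 = a] by move=> H; apply: n3; exists a.
have c1 := zclosed_fiber1; have c2 := zclosed_fiber2; have c3 := zclosed_fiber3.
have c12 := zclosedU (zclosedU (c1 None) (c1 (Some x1)))
  (zclosedU (c2 None) (c2 (Some x2))).
have c33 := zclosedU (c3 None) (c3 (Some x3)).
have : ~ Z `<=` (([set t | t.1.1 = None] `|` [set t | t.1.1 = Some x1]) `|`
   ([set t | t.1.2 = None] `|` [set t | t.1.2 = Some x2])) `|`
   ([set t | t.2 = None] `|` [set t | t.2 = Some x3]).
  apply: (fiber) => //; last exact: fiber.
  by apply: (fiber); [exact: zclosedU | exact: zclosedU | exact: fiber | exact: fiber].
move=> /existsNP[[[[t1|] [t2|]] [t3|]]] /not_implyP[Zt /= H]; try tauto.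
exists t1, t2, t3; split=> //.
all: apply: contra_not_neq H => ->; tauto.
Qed.
End ZariskiTopology.

(** * Row blocks of the lambda-matrix and the rank bound *)

Section LambdaMatrix.
Variable R : rcfType.

Lemma swap_defectE k (a b c d : dquat R) :
  dcoord (a * b - c * d - (c * a - d * b)) 0 k = swap_defect k (d + a) c b.
Proof.
rewrite /swap_defect mulrDl mulrDr; congr (dcoord _ 0 k).
by rewrite opprB addrACA -opprD [d * b + _]addrC.
Qed.

Variable L : 6.-tuple (dquat R).
Let M := lambda_matrix L.
Notation h i := (L`_i).

Lemma realify_rowE i k : exists2 u : 'rV_7, (u <= realify M)%MS &
  forall j, u 0 j = dcoord (M i j) 0 k.
Proof.
exists (row (mxvec_index i k) (realify M)); first exact: row_sub.
by move=> j; rewrite mxE mxE mxE mxvecE mxE.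
Qed.

Lemma realify_row_sub i i' k : exists2 u : 'rV_7, (u <= realify M)%MS &
  forall j, u 0 j = dcoord (M i j - M i' j) 0 k.
Proof.
have [u uM uE] := realify_rowE i k; have [v vM vE] := realify_rowE i' k.
exists (u - v); first by rewrite addmx_sub // eqmx_opp.
move=> j; rewrite mxE [X in _ + X]mxE uE vE dcoordD; congr (_ + _).
by rewrite -[- M i' j]scaleN1r dcoordZ mulN1r.
Qed.

Definition sum_minors_vanish := forall k k', [/\
    dcoord (h 0 + h 3) 0 k * dcoord (h 1 + h 4) 0 k' =
      dcoord (h 0 + h 3) 0 k' * dcoord (h 1 + h 4) 0 k,
    dcoord (h 0 + h 3) 0 k * dcoord (h 2 + h 5) 0 k' =
      dcoord (h 0 + h 3) 0 k' * dcoord (h 2 + h 5) 0 k &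
    dcoord (h 1 + h 4) 0 k * dcoord (h 2 + h 5) 0 k' =
      dcoord (h 1 + h 4) 0 k' * dcoord (h 2 + h 5) 0 k].

Lemma rank_le3_minors (u v : 'rV_7) (x y : 'I_7) : (\rank (realify M) <= 3)%N ->
  (u <= realify M)%MS -> (v <= realify M)%MS ->
  (forall j : 'I_7, (j < 3)%N -> u 0 j = 0) ->
  (forall j : 'I_7, (j < 3)%N -> v 0 j = 0) ->
  u 0 x != 0 -> v 0 x = 0 -> u 0 y = 0 -> v 0 y != 0 ->
  sum_minors_vanish.
Proof.
move=> r3 uM vM u0 v0 ux vx uy vy k k'.
have [a aM aE] := realify_rowE 0 k; have [b bM bE] := realify_rowE 0 k'.
have main (i j : 'I_7) : (i < 3)%N -> (j < 3)%N ->
    dcoord (M 0 i) 0 k * dcoord (M 0 j) 0 k' = dcoord (M 0 i) 0 k' * dcoord (M 0 j) 0 k.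
  move=> i3 j3; rewrite -!aE -!bE [RHS]mulrC.
  by apply: (minor_of_rank_le3 r3 aM bM uM vM _ _ _ _ ux vx uy vy); auto.
have M0 : M 0 0 = h 2 + h 5 by rewrite mxE.
have M1 : M 0 1 = h 1 + h 4 by rewrite mxE.
have M2 : M 0 2 = h 0 + h 3 by rewrite mxE.
by rewrite -M0 -M1 -M2; split; apply: main.
Qed.

Variable K : R -> R -> R -> Prop.
Hypothesis lineL : forall i : 'I_6, line (h i).
Hypothesis nonconstantK : nonconstant K.
Hypothesis closesK : forall t1 t2 t3, K t1 t2 t3 ->
  closes (h 0) (h 1) (h 2) (h 3) (h 4) (h 5) t1 t2 t3.

Let l1 : line (h 0) := lineL 0.
Let l2 : line (h 1) := lineL 1.
Let l3 : line (h 2) := lineL 2.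
Let l4 : line (h 3) := lineL 3.
Let l5 : line (h 4) := lineL 4.
Let l6 : line (h 5) := lineL 5.

(** All row blocks share their first three columns, which therefore cancel in a difference. *)
Lemma affine_row (i i' : 'I_6) k : exists2 u : 'rV_7, (u <= realify M)%MS &
  (forall j : 'I_7, (j < 3)%N -> u 0 j = 0) /\
  forall j : 'I_7, u 0 j = dcoord (M i j - M i' j) 0 k.
Proof.
have [u uM uE] := realify_row_sub i i' k; exists u => //; split=> // j j3.
rewrite uE; suff -> : M i j = M i' j by rewrite subrr dcoord0.
rewrite !mxE.
by case: j j3 {uE} => [[|[|[|//]]] ?] _ /=;
  case: i i' => [[|[|[|[|[|[|//]]]]]] ?] [[|[|[|[|[|[|//]]]]]] ?].
Qed.

(** Columns 3, 4, 5 of the lambda-matrix carry [t_3], [t_2], [t_1]. *)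
Definition affine_witness (x : 'I_7) := exists2 u : 'rV_7, (u <= realify M)%MS &
  [/\ forall j : 'I_7, (j < 3)%N -> u 0 j = 0, u 0 x = 0 &
   forall j : 'I_7, (2 < j < 6)%N -> j != x -> u 0 j != 0].

Lemma affine_row_sub (i i' : 'I_6) k (x : 'I_7) : M i x = M i' x ->
  (forall j : 'I_7, (2 < j < 6)%N -> j != x -> dcoord (M i j - M i' j) 0 k != 0) ->
  affine_witness x.
Proof.
move=> e H; have [u uM [u0 uE]] := affine_row i i' k; exists u => //; split=> //.
  by rewrite uE e subrr dcoord0.
by move=> j j6 jx; rewrite uE; apply: H.
Qed.

Ltac defects := case=> [[|[|[|[|[|[|//]]]]]] ?] // _ _;
  rewrite ![M _ _]mxE /= swap_defectE.

(** Blocks 0 and 1 agree in column 5 and differ in columns 3 and 4 by the defects of (h1, h4);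
    blocks 3 and 4 do the same for (h4, h1). The other two pairs use shifted blocks. *)
Lemma not_swapped1 : ~ pair_swapped (h 0) (h 1) (h 2) (h 3) (h 4) (h 5) ->
  affine_witness 5.
Proof.
move=> /(not_pair_swapped l1 l2 l3 l4 l5 l6 nonconstantK closesK)[k].
case=> -[d2 d3].
  apply: (@affine_row_sub 0 1 k); first by rewrite !mxE.
  by defects.
apply: (@affine_row_sub 3 4 k); first by rewrite !mxE.
by defects; rewrite addrC.
Qed.

Let nonconstantK' := nonconstant_rotate3 nonconstantK.
Let closesK' := closes_rotate3 l1 l4 closesK.
Let nonconstantK'' := nonconstant_rotate3 nonconstantK'.
Let closesK'' := closes_rotate3 l2 l5 closesK'.

Lemma not_swapped2 : ~ pair_swapped (h 1) (h 2) (h 3) (h 4) (h 5) (h 0) ->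
  affine_witness 4.
Proof.
move=> /(not_pair_swapped l2 l3 l4 l5 l6 l1 nonconstantK' closesK')[k].
case=> -[d2 d3].
  apply: (@affine_row_sub 1 2 k); first by rewrite !mxE.
  by defects; rewrite // addrC.
apply: (@affine_row_sub 4 5 k); first by rewrite !mxE.
by defects; rewrite // addrC.
Qed.

Lemma not_swapped3 : ~ pair_swapped (h 2) (h 3) (h 4) (h 5) (h 0) (h 1) ->
  affine_witness 3.
Proof.
move=> /(not_pair_swapped l3 l4 l5 l6 l1 l2 nonconstantK'' closesK'')[k].
case=> -[d2 d3].
  apply: (@affine_row_sub 2 3 k); first by rewrite !mxE.
  by defects; rewrite // addrC.
apply: (@affine_row_sub 5 0 k); first by rewrite !mxE.
by defects; rewrite // addrC.
Qed.

Lemma affine_witness_minors (x y : 'I_7) : (\rank (realify M) <= 3)%N -> x != y ->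
  (2 < x < 6)%N -> (2 < y < 6)%N -> affine_witness x -> affine_witness y ->
  sum_minors_vanish.
Proof.
move=> r3 xy x6 y6 [u uM [u0 ux uj]] [v vM [v0 vy vj]].
apply: (@rank_le3_minors u v y x r3 uM vM u0 v0 _ vy ux) => //.
  by apply: uj; rewrite // eq_sym.
exact: vj.
Qed.

Definition axis_or_parallel :=
  common_axis (h 0) (h 1) (h 2) (h 3) (h 4) (h 5) \/
  [\/ [/\ parallel (h 0) (h 3), parallel (h 1) (h 2) & parallel (h 4) (h 5)],
      [/\ parallel (h 1) (h 4), parallel (h 2) (h 3) & parallel (h 5) (h 0)] |
      [/\ parallel (h 2) (h 5), parallel (h 3) (h 4) & parallel (h 0) (h 1)]].

Lemma two_of_three_swapped : (\rank (realify M) <= 3)%N ->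
  [\/ pair_swapped (h 1) (h 2) (h 3) (h 4) (h 5) (h 0) /\
      pair_swapped (h 2) (h 3) (h 4) (h 5) (h 0) (h 1),
      pair_swapped (h 0) (h 1) (h 2) (h 3) (h 4) (h 5) /\
      pair_swapped (h 2) (h 3) (h 4) (h 5) (h 0) (h 1) |
      pair_swapped (h 0) (h 1) (h 2) (h 3) (h 4) (h 5) /\
      pair_swapped (h 1) (h 2) (h 3) (h 4) (h 5) (h 0)].
Proof.
move=> r3.
(* Two unswapped pairs would give two independent affine rows, hence vanishing minors of the sums,
   which in turn make one of the two pairs swapped. *)
have or_swapped P Q x y : x != y -> (2 < (x : 'I_7) < 6)%N -> (2 < (y : 'I_7) < 6)%N ->
    (~ P -> affine_witness x) -> (~ Q -> affine_witness y) ->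
    (sum_minors_vanish -> P \/ Q) -> P \/ Q.
  move=> xy x6 y6 nP nQ m; apply: contrapT => /[dup] nPQ /not_orP[/nP wx /nQ wy].
  by apply/nPQ/m; exact: affine_witness_minors r3 xy x6 y6 wx wy.
have c12 : pair_swapped (h 0) (h 1) (h 2) (h 3) (h 4) (h 5) \/
    pair_swapped (h 1) (h 2) (h 3) (h 4) (h 5) (h 0).
  apply: (or_swapped _ _ 5 4) => // [||m]; [exact: not_swapped1|exact: not_swapped2|].
  by apply: (swapped_of_minors l1 l2 l3 l4 l5 l6 nonconstantK closesK) => k k';
    case: (m k k').
have c23 : pair_swapped (h 1) (h 2) (h 3) (h 4) (h 5) (h 0) \/
    pair_swapped (h 2) (h 3) (h 4) (h 5) (h 0) (h 1).
  apply: (or_swapped _ _ 4 3) => // [||m]; [exact: not_swapped2|exact: not_swapped3|].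
  apply: (swapped_of_minors l2 l3 l4 l5 l6 l1 nonconstantK' closesK') => k k';
    case: (m k k') => e1 e2 e3; rewrite // ![h 3 + h 0]addrC.
  by rewrite mulrC -e1 mulrC.
have c31 : pair_swapped (h 2) (h 3) (h 4) (h 5) (h 0) (h 1) \/
    pair_swapped (h 0) (h 1) (h 2) (h 3) (h 4) (h 5).
  apply: (or_swapped _ _ 3 5) => // [||m]; [exact: not_swapped3|exact: not_swapped1|].
  have [||s|[s s']] := swapped_of_minors l3 l4 l5 l6 l1 l2 nonconstantK'' closesK''.
  - move=> k k'; case: (m k k') => e1 e2 e3; rewrite ![h 3 + h 0]addrC.
    by rewrite mulrC -e2 mulrC.
  - move=> k k'; case: (m k k') => e1 e2 e3; rewrite ![h 4 + h 1]addrC.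
    by rewrite mulrC -e3 mulrC.
  - by left.
  - by right; split; rewrite addrC; apply: swapsC.
by case: c12 c23 c31 => [s1|s2] [s2'|s3] [s3'|s1'];
  by [constructor 1|constructor 2|constructor 3].
Qed.

Lemma rank_le3_axis_or_parallel : (\rank (realify M) <= 3)%N -> axis_or_parallel.
Proof.
move=> r3; have [t1 [t2 [t3 [Kt _ _ _]]]] := nonconstantK 0 0 0.
have E := closesK Kt; have E' := closes_shift l1 l4 E; have E'' := closes_shift l2 l5 E'.
(* In each case the closure equation is rotated so that the two swapped pairs become pairs 2 and
   3. *)
case: (two_of_three_swapped r3) =>
  [[[s32 s12] [s13 s23]]|[[s21 s31] [s13 s23]]|[[s21 s31] [s32 s12]]].
- rewrite addrC in s12; rewrite addrC in s13; rewrite addrC in s23.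
  have [|p] := two_pairs_swapped l1 l2 l3 l4 l5 l6 E s12 s32 s13 s23; first by left.
  by right; constructor 1.
- rewrite addrC in s23.
  have s31' := swapsC s31; have s21' := swapsC s21.
  have [[g [gN g0 a b c]]|p] := two_pairs_swapped l2 l3 l4 l5 l6 l1 E' s23 s13 s21' s31'.
    by left; exists g; split=> //; apply: swapsC.
  by right; constructor 2.
- have s12' := swapsC s12; have s21' := swapsC s21.
  rewrite addrC in s21'.
  have [[g [gN g0 a b c]]|p] := two_pairs_swapped l3 l4 l5 l6 l1 l2 E''
    (swapsC s31) s21' (swapsC s32) s12'.
    by left; exists g; split=> //; apply: swapsC.
  by right; constructor 3.
Qed.

End LambdaMatrix.

Theorem theorem2 (R : realType) (L : 6.-tuple (dquat R))
    (hL : is_linkage L)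
    (hdim : zdim_lt (K_sym (complexify L)) 2)
    (hK0 : exists K0 : set (P1_3 R),
       nondegenerate_component L K0 /\ K0 `<=` K_sym_plus L)
    (r : nat) (hr : r = \rank (realify (lambda_matrix L)))
    (hr23 : r = 2%N \/ r = 3%N) :
  line_symmetric L \/ parallel_property L.
Proof.
have [K0 [[[_ irr _] _ n1 n2 n3] K0plus]] := hK0.
have lineL (i : 'I_6) : line L`_i.
  by rewrite -tnth_nth; apply: line_of_sqr; exact: hL.
have r3 : (\rank (realify (lambda_matrix L)) <= 3)%N by rewrite -hr; case: hr23 => ->.
pose K t1 t2 t3 := K0 (Some t1, Some t2, Some t3).
have closesK t1 t2 t3 : K t1 t2 t3 ->
    closes L`_0 L`_1 L`_2 L`_3 L`_4 L`_5 t1 t2 t3.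
  by move=> /K0plus[].
have [[g [gN g0 s14 s25 s36]]|] := rank_le3_axis_or_parallel lineL
  (zirreducible_finite_point irr n1 n2 n3) closesK r3.
  have [l ll lE] := exists_axis gN g0.
  by left; exists l; split=> //; exact: lE.
(* The three parallel alternatives are the parallel property after rotation by 0, 1 and 2. *)
move=> p; right; rewrite /parallel_property; move: p (size_tuple L) => /=.
case: (tval L) => [|a [|b [|c [|d [|e [|f [|? ?]]]]]]] //= p _.
by case: p => p; [exists 0%N | exists 1%N | exists 2%N].
Qed.
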